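(* For any hypergraph $H$ with $R(H)=\{1,2\}$, letting $H^2$ be the graph of its $2$-edges, \[\pi(H)=\begin{cases} 2-\frac{1}{\chi(H^2)-1} & \text{if } H^2 \text{ is not bipartite};\\ \frac54 & \text{if } H^2 \text{ is bipartite and } \min\{k:\bar P_{2k}\subseteq H\}=1;\\ \frac98 & \text{if } H^2 \text{ is bipartite and } \min\{k:\bar P_{2k}\subseteq H\}\ge 2;\\ 1 & \text{if } H^2 \text{ is bipartite and } \bar P_{2k}\not\subseteq H \text{ for every } k\ge1.\end{cases}\]
   Context: A hypergraph $H=(V,E)$ has finite vertex set $V$ and edge set $E\subseteq 2^V$; $R(H)=\{|F|:F\in E\}$. $H_1\subseteq H_2$ (subgraph) means there is an injective $f\colon V(H_1)\to V(H_2)$ with $f(F)\in E(H_2)$ for all $F\in E(H_1)$. For $G$ on $n$ vertices, $h_n(G)=\sum_{F\in E(G)}1/\binom{n}{|F|}$; $\pi_n(H)=\max\{h_n(G): G\text{ on } n \text{ vertices}, R(G)\subseteq R(H), H\not\subseteq G\}$ and $\pi(H)=\lim_n\pi_n(H)$. $\chi$ denotes chromatic number. A closed path of length $m$, $\bar P_m$, is the hypergraph with vertices $x_1,\dots,x_m$, $1$-edges $\{x_1\},\{x_m\}$ and $2$-edges $\{x_i,x_{i+1}\}$, $1\le i\le m-1$. *)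

(* Defs.v *)
From mathcomp Require Import all_boot all_order all_algebra.
From mathcomp Require Import all_classical all_reals topology normedtype sequences.
Set Implicit Arguments. Unset Strict Implicit. Unset Printing Implicit Defensive.
Import Order.TTheory GRing.Theory Num.Theory.

(* A hypergraph on a finite vertex type T is given by its edge set E. *)

Definition rank12 (T : finType) (E : {set {set T}}) : Prop :=
  (forall F, F \in E -> #|F| = 1%N \/ #|F| = 2%N) /\
  (exists F, F \in E /\ #|F| = 1%N) /\ (exists F, F \in E /\ #|F| = 2%N).

Definition ranks_sub (T1 T2 : finType) (E1 : {set {set T1}}) (E2 : {set {set T2}}) : Prop :=
  forall F, F \in E1 -> exists F', F' \in E2 /\ #|F'| = #|F|.

Definition subhg (T1 T2 : finType) (E1 : {set {set T1}}) (E2 : {set {set T2}}) : Prop :=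
  exists f : T1 -> T2, injective f /\ forall F, F \in E1 -> f @: F \in E2.

Definition hdens (R : realType) (n : nat) (E : {set {set 'I_n}}) : R :=
  (\sum_(F in E) ('C(n, #|F|)%:R)^-1)%R.

(* pi_n(H): maximum of h_n over admissible G (the empty G is admissible whenever
   E is nonempty, and h_n >= 0, so the max with 0 is the true maximum) *)
Definition pin (R : realType) (T : finType) (E : {set {set T}}) (n : nat) : R :=
  \big[Num.max/0%R]_(G : {set {set 'I_n}} | `[< ranks_sub G E /\ ~ subhg E G >]) hdens R G.

Definition colorable (T : finType) (E : {set {set T}}) (k : nat) : bool :=
  [exists f : {ffun T -> 'I_k}, [forall F in E, (#|F| == 2%N) ==>
     [forall x in F, [forall y in F, (x != y) ==> (f x != f y)]]]].

Lemma colorable_ex (T : finType) (E : {set {set T}}) : exists k, colorable E k.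
Proof.
exists #|T|; apply/existsP; exists [ffun x => enum_rank x].
apply/forall_inP => F _; apply/implyP => _.
apply/forall_inP => x _; apply/forall_inP => y _; apply/implyP => nxy.
by rewrite !ffunE (inj_eq enum_rank_inj).
Qed.

Definition chi (T : finType) (E : {set {set T}}) : nat :=
  ex_minn (colorable_ex E).

Definition bipartite (T : finType) (E : {set {set T}}) : bool := colorable E 2.

(* closed path \bar P_m on vertices 'I_m (x_{i+1} <-> i) *)
Definition closed_path (m : nat) : {set {set 'I_m}} :=
  [set F : {set 'I_m} | [exists i : 'I_m, (F == [set i]) &&
                               ((val i == 0%N) || (val i == m.-1))]
                     || [exists i : 'I_m, exists j : 'I_m,
                               (val j == (val i).+1) && (F == [set i; j])]].

(* Main.v *)
Require Import Defs.
From mathcomp Require Import all_boot all_order all_algebra.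
From mathcomp Require Import all_classical all_reals topology normedtype sequences.
From mathcomp Require Import zify ring lra.
Set Implicit Arguments. Unset Strict Implicit. Unset Printing Implicit Defensive.
Import Order.TTheory GRing.Theory Num.Theory numFieldNormedType.Exports.
Local Open Scope ring_scope.

(* For a hypergraph G on n vertices whose edges have size 1 or 2, let S be the set
   of its 1-edges, s := #|S|, and let e be the number of ordered pairs of adjacent
   vertices. Then h_n(G) = s / n + e / (n (n - 1)), so everything is about the
   maximum of (s n + e) / n^2. For the upper bounds, if h_n(G) exceeds the
   claimed limit then G contains a blow-up into which H embeds:
   - for H^2 not bipartite, or bipartite with limit 5/4, S spans enough pairs for
     the Erdos-Stone theorem inside S, as e <= e(S, S) + n^2 - s^2;
   - when H contains no even closed path, H^2 has a 2-colouring whose first class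
     contains all 1-edges, and the linear number of vertices with linear degree
     into S yields a complete bipartite graph with one side in S;
   - when H contains even closed paths but not P_2, H is contained in a blow-up of
     P_4. With B the vertices outside S of linear degree into S, b := #|B|, either
     S or B is dense and the blow-up is found, or
     s n + e <= (n - b) (n + 2 b) + o(n^2) <= (9 / 8 + o(1)) n^2.
   The lower bounds are the Turan graph with all 1-edges; the complete graph minus
   a clique on half of the vertices, which are the 1-edges; the complete bipartite
   graph whose 1-edges are one side, of size 3 n / 4; and all 1-edges alone. *)

(** * Degrees and edge counts *)

Definition deg (V : finType) (r : rel V) (Y : {set V}) (x : V) : nat :=
  #|[set y in Y | r x y]|.

(** Ordered pairs are counted, so for symmetric and irreflexive [r] an edge inside [X] contributes 2
    to [edges r X X]; this avoids halves throughout. *)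
Definition edges (V : finType) (r : rel V) (X Y : {set V}) : nat :=
  \sum_(x in X) deg r Y x.

Definition complete (V : finType) (r : rel V) (X Y : {set V}) : bool :=
  [forall x in X, forall y in Y, r x y].

Section Counting.
Local Open Scope nat_scope.
Variables (V : finType) (r : rel V).
Implicit Types X Y Z A : {set V}.

Lemma completeP X Y :
  reflect (forall x y, x \in X -> y \in Y -> r x y) (complete r X Y).
Proof.
apply: (iffP forall_inP) => [h x y /h /forall_inP h'|h x xX]; first exact: h'.
by apply/forall_inP => y; apply: h.
Qed.

Lemma complete_sub X Y X' Y' :
  X' \subset X -> Y' \subset Y -> complete r X Y -> complete r X' Y'.
Proof.
move=> sX sY /completeP h; apply/completeP => x y /(fintype.subsetP sX) xX.
by move=> /(fintype.subsetP sY); apply: h.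
Qed.

Lemma degE Y x : deg r Y x = \sum_(y in Y) r x y.
Proof. by rewrite /deg -sum1dep_card big_mkcondr. Qed.

Lemma deg_le Y x : deg r Y x <= #|Y|.
Proof. by apply: subset_leq_card; apply/fintype.subsetP => y; rewrite inE => /andP[]. Qed.

Lemma edges_le X Y : edges r X Y <= #|X| * #|Y|.
Proof.
rewrite /edges -sum_nat_const; apply: leq_sum => x _; exact: deg_le.
Qed.

Lemma edgesC X Y : symmetric r -> edges r X Y = edges r Y X.
Proof.
move=> sr; rewrite /edges.
under eq_bigr do rewrite degE.
under [RHS]eq_bigr do rewrite degE.
rewrite exchange_big /=; apply: eq_bigr => y _; apply: eq_bigr => x _.
by rewrite sr.
Qed.

Lemma edges_splitl A X Y :
  edges r X Y = edges r (X :&: A) Y + edges r (X :\: A) Y.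
Proof. by rewrite /edges (big_setID A). Qed.

Lemma edges_splitr A X Y : symmetric r ->
  edges r X Y = edges r X (Y :&: A) + edges r X (Y :\: A).
Proof.
by move=> sr; rewrite edgesC // (edges_splitl A) !(edgesC X).
Qed.

Lemma edges_ge X Y d : (forall x, x \in X -> d <= deg r Y x) ->
  #|X| * d <= edges r X Y.
Proof. by move=> h; rewrite -sum_nat_const; apply: leq_sum. Qed.

(** Vertices of degree at least [D] contribute at most [#|Y|] each, the others at most [D] each. *)
Lemma edges_rich X Y D :
  edges r X Y <= #|[set x in X | D <= deg r Y x]| * #|Y| + D * #|X|.
Proof.
rewrite (edges_splitl [set x | D <= deg r Y x]); apply: leq_add.
  apply: leq_trans (edges_le _ _) _; rewrite leq_mul2r; apply/orP; right.
  by apply: subset_leq_card; apply/fintype.subsetP => x; rewrite !inE.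
rewrite mulnC; apply: (@leq_trans (\sum_(x in X :\: [set x | D <= deg r Y x]) D)).
  by apply: leq_sum => x; rewrite !inE -ltnNge => /andP[/ltnW].
by rewrite sum_nat_const leq_mul2r subset_leq_card ?orbT // subsetDl.
Qed.

(* Among the vertices of X with many neighbours in U, a positive proportion
   have the same neighbourhood in U, since U has only 2 ^ #|U| subsets. *)
Lemma common_neighbourhood (U X : {set V}) D m :
  0 < m -> #|X| <= m -> D.+1 * m <= edges r X U ->
  exists W X' : {set V}, [/\ W \subset U, D <= #|W|, X' \subset X, complete r X' W
    & m <= #|X'| * (#|U| * 2 ^ #|U|)].
Proof.
move=> m_gt0 Xm eXU.
set P := [set x in X | D <= deg r U x].
(* Vertices outside [P] account for at most [D * m] edges, so at least [m] edges start in [P]. *)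
have mP : m <= #|P| * #|U|.
  have := edges_rich X U D; rewrite -/P.
  have : D * #|X| <= D * m by rewrite leq_mul2l Xm orbT.
  by move: eXU; rewrite mulSn; lia.
pose nb x := [set y in U | r x y].
pose fib W := [set x in P | nb x == W].
have [W [WU hW]] : exists W : {set V}, W \in powerset U /\ #|P| <= #|fib W| * 2 ^ #|U|.
  apply/not_existsP => H.
  have U_in : U \in powerset U by rewrite inE.
  have cP : #|P| = \sum_(W in powerset U) #|fib W|.
    rewrite -sum1_card (partition_big nb (mem (powerset U))) /=; last first.
      by move=> x _; rewrite inE; apply/fintype.subsetP => y; rewrite inE => /andP[].
    by apply: eq_bigr => W _; rewrite sum1dep_card; apply: eq_card => x; rewrite !inE.
  (* Averaging by contradiction; the term for [U] is singled out to make the inequality strict. *)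
  have : 2 ^ #|U| * #|P| < 2 ^ #|U| * #|P|.
    rewrite [X in _ < X]mulnC {1}cP big_distrr /= -card_powerset mulnC -sum_nat_const.
    rewrite card_powerset (bigD1 U) //= [X in _ < X](bigD1 U) //= -addSn leq_add //.
      by rewrite mulnC ltnNge; apply/negP => h; apply: (H U).
    apply: leq_sum => W /andP[WU _]; rewrite mulnC leqNgt; apply/negP => h; apply: (H W).
    by split => //; apply: ltnW.
  by rewrite ltnn.
exists W, (fib W); rewrite inE in WU.
have P0 : 0 < #|fib W|.
  by rewrite lt0n; apply/eqP => f0; move: mP hW; rewrite f0; lia.
split => //.
- have [x] := card_gt0P P0; rewrite !inE => /andP[/andP[_ h] /eqP <-].
  exact: h.
- by apply/fintype.subsetP => x; rewrite !inE => /andP[/andP[]].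
- apply/completeP => x y; rewrite inE => /andP[_ /eqP <-].
  by rewrite inE => /andP[].
- apply: leq_trans mP _; rewrite mulnCA mulnC leq_mul2l hW orbT //.
Qed.

End Counting.

(** * The Erdos-Stone theorem *)

Definition trim (V : finType) (t : nat) (A : {set V}) : {set V} :=
  [set x in take t (enum A)].

Definition union_seq (V : finType) (s : seq {set V}) : {set V} :=
  [set x | has (fun A : {set V} => x \in A) s].

(** For irreflexive [r] the parts are pairwise disjoint, since a common vertex would be related to
    itself. *)
Definition multipartite (V : finType) (r : rel V) (S : {set V}) (t : nat)
    (s : seq {set V}) : bool :=
  all (fun A : {set V} => (A \subset S) && (#|A| == t)) s && pairwise (complete r) s.

Section ErdosStone.
Local Open Scope nat_scope.

Lemma trim_sub (V : finType) t (A : {set V}) : trim t A \subset A.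
Proof. by apply/fintype.subsetP => x; rewrite inE => /mem_take; rewrite mem_enum. Qed.

Lemma card_trim (V : finType) t (A : {set V}) : t <= #|A| -> #|trim t A| = t.
Proof.
move=> tA; rewrite cardsE; have /card_uniqP -> : uniq (take t (enum A)).
  by rewrite take_uniq ?enum_uniq.
by rewrite size_take_min -cardE; apply/minn_idPl.
Qed.

Lemma card_union_seq (V : finType) (r : rel V) S t s : irreflexive r ->
  multipartite r S t s -> #|union_seq s| = size s * t.
Proof.
move=> ir; elim: s => [|A s IH]; first by move=> _; apply: eq_card0 => x; rewrite inE.
rewrite /multipartite /= => /andP[/andP[/andP[_ /eqP cA] hs]] /andP[cAs ps].
have /IH cs : multipartite r S t s by rewrite /multipartite hs ps.
have -> : union_seq (A :: s) = A :|: union_seq s by apply/setP => x; rewrite !inE.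
rewrite cardsU cA cs mulSn.
suff -> : A :&: union_seq s = finset.set0 by rewrite cards0 subn0.
apply/setP => x; rewrite !inE; apply/negP => /andP[xA /hasP[B Bs xB]].
by have /allP/(_ B Bs)/completeP/(_ x x xA xB) := cAs; rewrite ir.
Qed.

(* Induction step: a vertex of S is adjacent on average to at least (k + eps) T
   vertices of a complete k.+1-partite subgraph with parts of size T, so many
   vertices have t neighbours in each part, and many of these have the same
   neighbourhood. The condition is multiplied by k so that k = 0 makes sense. *)
Lemma erdos_stone_mindeg (R : realType) (k t : nat) (eps : R) : (0 < eps)%R ->
  exists N : nat, forall (V : finType) (r : rel V) (S : {set V}),
    symmetric r -> irreflexive r -> N <= #|S| ->
    (forall x, x \in S ->
      (k%:R - 1 + eps) * #|S|%:R <= k%:R * (deg r S x)%:R :> R)%R ->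
    exists s, size s = k.+1 /\ multipartite r S t s.
Proof.
elim: k t eps => [|k IH] t eps eps0.
  exists t => V r S _ _ tS _; exists [:: trim t S]; split => //.
  by rewrite /multipartite /= trim_sub card_trim // eqxx.
(* [T] is so large that the excess [eps * T] covers the [t.+1] extra neighbours needed in [eU]. *)
pose T := Num.bound (t.+1%:R / eps)%R.
have hT : (t.+1%:R <= eps * T%:R)%R.
  rewrite mulrC -ler_pdivrMr //; apply/ltW/archi_boundP.
  by apply: divr_ge0 => //; exact: ltW.
(* All degrees are at least [k / (k + 1)] of [#|S|], and [k^2 / (k + 1) = k - 1 + 1 / (k + 1)],
   which explains this excess. *)
have [N hN] := IH T (k.+1%:R^-1)%R ltac:(by rewrite invr_gt0 ltr0n).
pose u := k.+1 * T.
exists (maxn N (maxn (t * (u * 2 ^ u)) 1)) => V r S sr ir.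
rewrite !geq_max => /and3P[NS tS S0] hdeg.
have [s [ss ms]] : exists s, size s = k.+1 /\ multipartite r S T s.
  apply: hN => // x xS; have := hdeg x xS.
  set d := ((deg r S x)%:R)%R; set m := (#|S|%:R)%R => hd.
  have k1 : (0 < k.+1%:R :> R)%R by rewrite ltr0n.
  have m0 : (0 <= m)%R by rewrite ler0n.
  rewrite -(ler_pM2l k1).
  have e : (k.+1%:R * ((k%:R - 1 + k.+1%:R^-1) * m) = k%:R * k%:R * m :> R)%R.
    by rewrite -natr1; field; rewrite natr1 pnatr_eq0.
  rewrite e mulrCA -mulrA; apply: ler_wpM2l; first exact: ler0n.
  apply: le_trans hd; rewrite -natr1; have := mulr_ge0 (ltW eps0) m0; lra.
have cU := card_union_seq ir ms; rewrite ss -/u in cU.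
set U := union_seq s in cU.
move: (ms) => /andP[/allP hs ps].
have US : U \subset S.
  apply/fintype.subsetP => x; rewrite inE => /hasP[A /hs /andP[/fintype.subsetP AS _] xA].
  exact: AS.
have eU : (k * T + t).+1 * #|S| <= edges r S U.
  rewrite edgesC // -(ler_nat R) /edges natr_sum.
  have k1 : (0 < k.+1%:R :> R)%R by rewrite ltr0n.
  rewrite -(ler_pM2l k1) mulr_sumr.
  apply: (@le_trans _ _ (\sum_(x in U) (k.+1%:R - 1 + eps) * #|S|%:R)%R); last first.
    by apply: ler_sum => x xU; apply: hdeg; apply: (fintype.subsetP US).
  rewrite sumr_const cU /u -[X in (_ <= X)%R]mulr_natl !natrM.
  rewrite -[X in (_ <= X)%R]mulrA ler_pM2l //.
  rewrite mulrA; apply: ler_wpM2r; first exact: ler0n.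
  rewrite -[(k.+1%:R)%R]natr1 addrK -addnS natrD natrM; move: hT; lra.
have [W [X [WU cW XS cXW hX]]] := common_neighbourhood S0 (leqnn _) eU.
rewrite cU in hX.
have uu : 0 < u * 2 ^ u by rewrite lt0n; apply/eqP => z; move: hX; rewrite z; lia.
have tX : t <= #|X| by rewrite -(leq_pmul2r uu) (leq_trans tS).
(* [W] has at least [k * T + t] elements, of which at most [k * T] lie outside the part [A]. *)
have AW (A : {set V}) : A \in s -> t <= #|A :&: W|.
  move=> As; have /andP[AS /eqP cA] := hs A As.
  have AU : A \subset U.
    by apply/fintype.subsetP => x xA; rewrite inE; apply/hasP; exists A.
  have : #|W :\: A| <= #|U :\: A| by apply: subset_leq_card; apply: finset.setSD.
  have := cardsD U A; rewrite (finset.setIidPr AU) cU cA.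
  have := cardsID A W; rewrite [W :&: A]finset.setIC /u mulSn; move: cW.
  by set a := #|_|; set b := #|_|; set c := #|_|; set d := #|_|; lia.
exists (trim t X :: [seq trim t (A :&: W) | A : {set V} <- s]); split.
  by rewrite /= size_map ss.
rewrite /multipartite /= (fintype.subset_trans (trim_sub _ _) XS) card_trim // eqxx /=.
apply/and3P; split.
- apply/allP => _ /mapP[A As ->]; rewrite card_trim ?AW // eqxx andbT.
  apply: (fintype.subset_trans (trim_sub _ _)).
  by apply: (fintype.subset_trans (finset.subsetIl _ _)); have /andP[] := hs A As.
- apply/allP => _ /mapP[A As ->]; apply: complete_sub cXW; first exact: trim_sub.
  by apply: (fintype.subset_trans (trim_sub _ _)); apply: finset.subsetIr.
- rewrite pairwise_map; apply: sub_pairwise ps => A B; apply: complete_sub.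
    by apply: (fintype.subset_trans (trim_sub _ _)); apply: finset.subsetIl.
  by apply: (fintype.subset_trans (trim_sub _ _)); apply: finset.subsetIl.
Qed.

End ErdosStone.

Lemma edges_setD1 (V : finType) (r : rel V) (S : {set V}) (v : V) :
  symmetric r -> irreflexive r -> v \in S ->
  (edges r S S = edges r (S :\ v) (S :\ v) + (deg r S v).*2)%N.
Proof.
move=> sr ir vS.
have e1 Y : edges r (S :&: [set v]) Y = deg r Y v.
  have /finset.setIidPr -> : [set v] \subset S by rewrite finset.sub1set.
  by rewrite /edges finset.big_set1.
rewrite (edges_splitl r [set v]) e1 (edges_splitr [set v] (S :\ v)) //.
rewrite (edgesC (S :\ v) (S :&: _)) // e1.
have -> : deg r (S :\ v) v = deg r S v.
  apply: eq_card => y; rewrite !inE; case: eqP => [->|_] /=; last by [].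
  by rewrite ir andbF.
by rewrite -addnn; lia.
Qed.

(* A subset maximizing [edges X X - a #|X|^2]: deleting a vertex cannot
   increase this quantity. *)
Lemma mindeg_subset (R : realType) (V : finType) (r : rel V) (S : {set V}) (a : R) :
  symmetric r -> irreflexive r ->
  exists S' : {set V}, [/\ S' \subset S,
    forall v, v \in S' -> a * (2 * #|S'|%:R - 1) <= 2 * (deg r S' v)%:R
    & (edges r S S)%:R - a * #|S|%:R ^+ 2 <=
      (edges r S' S')%:R - a * #|S'|%:R ^+ 2].
Proof.
move=> sr ir.
pose phi (X : {set V}) : R := (edges r X X)%:R - a * #|X|%:R ^+ 2.
case: (@Order.TotalTheory.arg_maxP _ _ _ S (fun X : {set V} => X \subset S) phi
         (subxx _)) => S' S'S hmax.
exists S'; split => // [v vS'|]; last exact: hmax.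
have := hmax (S' :\ v) (fintype.subset_trans (finset.subD1set _ _) S'S).
rewrite /phi (edges_setD1 sr ir vS') (cardsD1 v S') vS' -mul2n natrD natrM /=.
rewrite natrD; lra.
Qed.

(** [mindeg_subset] turns average degree into minimum degree at the price of part of the excess. The
    subset it returns is still linear in [#|V|], because it must hold the excess pairs itself. The
    case [k = 0] is the one used for bipartite [H^2]. *)
Lemma erdos_stone (R : realType) (k t : nat) (eps : R) : 0 < eps ->
  exists N : nat, forall (V : finType) (r : rel V) (S : {set V}),
    symmetric r -> irreflexive r -> (N <= #|V|)%N ->
    k%:R * #|S|%:R ^+ 2 + eps * #|V|%:R ^+ 2 <= k.+1%:R * (edges r S S)%:R :> R ->
    exists s, size s = k.+2 /\ multipartite r S t s.
Proof.
move=> eps0.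
have [N hN] := @erdos_stone_mindeg R k.+1 t (eps / 4) ltac:(lra).
have k0 : 0 <= k%:R :> R by exact: ler0n.
have k1 : 0 < k.+1%:R :> R by rewrite ltr0n.
(* With at least [M] vertices, the remaining excess absorbs the [- 1] in the degree bound of
   [mindeg_subset]. *)
pose M := (N + Num.bound (2 * (k%:R + eps) / eps))%N.
have hM : 2 * (k%:R + eps) <= eps * M%:R.
  have := archi_boundP (_ : 0 <= 2 * (k%:R + eps) / eps); rewrite /M natrD.
  set b := (Num.bound _)%:R; move=> /(_ ltac:(apply: divr_ge0; lra)).
  rewrite ltr_pdivrMr // => hb.
  have : 0 <= eps * N%:R by rewrite mulr_ge0 ?ler0n // ltW.
  lra.
(* Chosen so that [k.+1%:R * d ^+ 2 <= eps / 2], which forces the subset to have at least [d * #|V|]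
   vertices. *)
pose d := Num.min 1 (eps / (2 * k.+1%:R)).
have d0 : 0 < d by rewrite lt_min ltr01 divr_gt0 // mulr_gt0.
have d1 : d <= 1 by rewrite ge_min lexx.
have d2 : 2 * k.+1%:R * d <= eps.
  by rewrite mulrC -ler_pdivlMr ?mulr_gt0 // ge_min lexx orbT.
exists (Num.bound (M%:R / d)) => V r S sr ir hV hS.
set n := #|V|%:R in hS; set e := (edges r S S)%:R in hS; set m := #|S|%:R in hS.
have hn : M%:R <= d * n.
  rewrite mulrC -ler_pdivrMr //; apply: ltW; apply: lt_le_trans (archi_boundP _) _.
    by rewrite divr_ge0 ?ler0n // ltW.
  by rewrite ler_nat.
have mn : m <= n by rewrite ler_nat max_card.
have m0 : 0 <= m by exact: ler0n.
have n0 : 0 <= n by exact: ler0n.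
pose a := (k%:R + eps / 2) / k.+1%:R : R.
have ha : k.+1%:R * a = k%:R + eps / 2 by rewrite mulrC divfK ?gt_eqF.
clearbody a.
have [S' [S'S hdeg hphi]] := mindeg_subset S a sr ir.
rewrite -/e -/m in hphi.
have e'le : (edges r S' S')%:R <= #|S'|%:R ^+ 2 :> R.
  by rewrite expr2 -natrM ler_nat edges_le.
set m' := #|S'|%:R in hdeg hphi e'le.
have m'0 : 0 <= m' by exact: ler0n.
have big : M%:R <= m'.
  apply: le_trans hn _.
  have h1 : eps / 2 * n ^+ 2 <= k.+1%:R * m' ^+ 2.
    have := ler_wpM2l (ltW k1) hphi; rewrite !mulrBr ![k.+1%:R * (a * _)]mulrA !ha.
    have := ler_wpM2l (ltW k1) e'le.
    have : 0 <= (k%:R + eps / 2) * m' ^+ 2 by rewrite mulr_ge0 ?sqr_ge0 //; lra.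
    have : eps * m ^+ 2 <= eps * n ^+ 2 by rewrite ler_pM2l // lerXn2r.
    move: hS; lra.
  have h2 : k.+1%:R * (d * n) ^+ 2 <= k.+1%:R * m' ^+ 2.
    apply: le_trans h1; rewrite exprMn mulrA; apply: ler_wpM2r; first exact: sqr_ge0.
    have : k.+1%:R * d ^+ 2 <= k.+1%:R * d.
      by rewrite ler_pM2l // expr2 ler_piMl // ltW.
    lra.
  by move: h2; rewrite ler_pM2l // ler_sqr // nnegrE mulr_ge0 // ltW.
have [s [ss ms]] : exists s, size s = k.+2 /\ multipartite r S' t s.
  apply: hN => //.
    by rewrite -(ler_nat R); apply: le_trans big; rewrite ler_nat leq_addr.
  move=> v vS'; have := hdeg v vS'; rewrite -/m' => /(ler_wpM2l (ltW k1)).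
  rewrite [k.+1%:R * (a * _)]mulrA ha -{2}[k.+1%:R]natr1 addrK => h.
  have : eps * M%:R <= eps * m' by rewrite ler_wpM2l // ltW.
  lra.
exists s; split => //; move: ms => /andP[/allP hs ps]; rewrite /multipartite ps andbT.
apply/allP => A /hs /andP[AS' ->]; rewrite andbT.
exact: fintype.subset_trans AS' S'S.
Qed.

(** * Hypergraphs with edges of size 1 and 2 *)

Definition rank_1_or_2 (T : finType) (G : {set {set T}}) : Prop :=
  forall F, F \in G -> #|F| = 1%N \/ #|F| = 2%N.

Definition singles (T : finType) (E : {set {set T}}) : {set T} :=
  [set x | [set x] \in E].

Definition adj (T : finType) (E : {set {set T}}) : rel T :=
  fun x y => (x != y) && ([set x; y] \in E).

Section Hypergraphs.
Variables (T : finType) (E : {set {set T}}).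

Lemma adj_sym : symmetric (adj E).
Proof. by move=> x y; rewrite /adj eq_sym finset.setUC. Qed.

Lemma adj_irr : irreflexive (adj E).
Proof. by move=> x; rewrite /adj eqxx. Qed.

Lemma card_singles : #|[set F in E | #|F| == 1%N]| = #|singles E|.
Proof.
rewrite -(card_imset (singles E) set1_inj); apply: eq_card => F; rewrite !inE.
apply/andP/imsetP => [[FE /cards1P[x Fx]]|[x]]; last first.
  by rewrite inE => xE ->; rewrite cards1.
by exists x; rewrite ?inE -?Fx.
Qed.

Lemma deg_adj x : deg (adj E) [set: T] x = #|[set F in E | (#|F| == 2%N) && (x \in F)]|.
Proof.
rewrite /deg -(@card_in_imset _ _ (fun y => [set x; y])); last first.
  move=> y z; rewrite !inE /adj => /andP[_ /andP[xy _]] /andP[_ /andP[xz _]] /setP/(_ y).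
  by rewrite !inE eqxx orbT eq_sym (negPf xy) => /esym/eqP.
apply: eq_card => F; rewrite !inE; apply/imsetP/and3P => [[y]|[FE /cards2P]].
  rewrite !inE /adj => /andP[_ /andP[xy FE]] ->; split => //; first by rewrite cards2 xy.
  by rewrite !inE eqxx.
case=> a [b [ab Fab]]; rewrite Fab !inE => /orP[]/eqP xa.
  by exists b; rewrite ?xa // !inE /adj ab -Fab.
exists a; last by rewrite xa finset.setUC.
by rewrite !inE /adj xa eq_sym ab finset.setUC -Fab.
Qed.

(** Double counting of the incidences between vertices and 2-edges. *)
Lemma edges_adj :
  edges (adj E) [set: T] [set: T] = (2 * #|[set F in E | #|F| == 2]|)%N.
Proof.
rewrite /edges; under eq_bigr do rewrite deg_adj -sum1dep_card.
rewrite (eq_bigr (fun x => \sum_(F in [set F in E | #|F| == 2%N]) (x \in F : nat))%N);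
  last first.
  move=> x _; under eq_bigl do rewrite andbA.
  by rewrite big_mkcondr; apply: eq_bigl => F; rewrite inE.
rewrite exchange_big /= mulnC -sum_nat_const; apply: eq_bigr => F.
rewrite inE => /andP[_ /eqP <-]; rewrite -sum1_card [RHS]big_mkcond /=.
by apply: eq_bigl => x; rewrite inE.
Qed.

End Hypergraphs.

(** Edges of equal size have equal weight, and the 2 in [2 / (n (n - 1))] is the one of [edges_adj].
    For [n < 2] the formula rests on the inverse of 0 being 0. *)
Lemma hdensE (R : realType) n (G : {set {set 'I_n}}) :
  rank_1_or_2 G ->
  hdens R G = #|singles G|%:R / n%:R +
    (edges (adj G) [set: 'I_n] [set: 'I_n])%:R / (n%:R * (n%:R - 1)).
Proof.
move=> hG; rewrite /hdens (bigID (fun F : {set 'I_n} => #|F| == 1%N)) /=; congr (_ + _).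
  rewrite (eq_bigr (fun=> n%:R^-1)); last first.
    by move=> F /andP[_ /eqP ->]; rewrite bin1.
  rewrite sumr_const -card_singles -[LHS]mulr_natl; congr (_%:R * _).
  by apply: eq_card => F; rewrite !inE.
rewrite (eq_bigr (fun=> 2 / (n%:R * (n%:R - 1)))); last first.
  move=> F /andP[/hG [->//|-> _]].
  have e : n%:R * (n%:R - 1) = 'C(n, 2)%:R * 2 :> R.
    rewrite -natrM; have -> : ('C(n, 2) * 2 = n * n.-1)%N.
      by rewrite -[X in (_ * X)%N]/(2`!) bin_ffact ffactnS ffactn1.
    by case: (n) => [|m]; rewrite ?mul0n ?mul0r // natrM -[in m.+1%:R - 1]natr1 addrK.
  rewrite e invfM mulrCA divff ?mulr1 // pnatr_eq0 //.
rewrite sumr_const edges_adj mulnC natrM -[LHS]mulr_natl -[RHS]mulrA; congr (_%:R * _).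
apply: eq_card => F; rewrite [LHS]unfold_in inE; case FG: (F \in G) => //=.
by have [->|->] := hG F FG.
Qed.

(** * Embeddings into blow-ups *)

Lemma distinct_representatives (T V : finType) (A : T -> {set V}) :
  (forall x, #|T| <= #|A x|)%N -> exists f : T -> V, injective f /\ forall x, f x \in A x.
Proof.
move=> hA.
have [f0 hf0] : {f : T -> V & forall x, f x \in A x}.
  apply: (@choice _ _ (fun x y => y \in A x)) => x; apply/card_gt0P.
  by apply: leq_trans (hA x); apply/card_gt0P; exists x.
(* Greedy choice: when a vertex is reached, fewer than [#|T|] elements are already taken. *)
suff H (s : seq T) : uniq s ->
    exists f : T -> V, {in s &, injective f} /\ forall x, f x \in A x.
  have [f [fi fA]] := H (enum T) (enum_uniq _); exists f; split => // x y.
  by apply: fi; rewrite mem_enum.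
elim: s => [_|x s IH /= /andP[xs us]]; first by exists f0.
have [f [fi fA]] := IH us.
have [y yA yf] : exists2 y, y \in A x & y \notin [set f z | z in s].
  have /subsetPn [y yA yf] : ~~ (A x \subset [set f z | z in s]).
    apply/negP => /subset_leq_card; apply/negP; rewrite -ltnNge.
    apply: leq_trans (hA x); apply: leq_ltn_trans (leq_imset_card _ _) _.
    by rewrite -cardsT; apply: proper_card; apply/properP; split => //; exists x.
  by exists y.
exists (fun z => if z == x then y else f z); split => [z w|z]; last first.
  by case: eqP => [->|].
have nf v : v \in s -> y != f v.
  by move=> vs; apply: contraNneq yf => ->; apply: imset_f.
rewrite !inE; case: eqP => [->|zx] /=; case: eqP => [->|wx] //= zs ws.
- by move=> e; have := nf w ws; rewrite e eqxx.
- by move=> e; have := nf z zs; rewrite e eqxx.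
- exact: fi.
Qed.

(** Distinct representatives exist for any family of sets with at least [#|T|] elements, so the sets
    [A x] may coincide, and the uses below share one set among many vertices. *)
Lemma subhg_blowup (T V : finType) (E : {set {set T}}) (G : {set {set V}})
    (A : T -> {set V}) :
  rank_1_or_2 E ->
  (forall x, #|T| <= #|A x|)%N ->
  (forall x, x \in singles E -> A x \subset singles G) ->
  (forall x y, adj E x y -> complete (adj G) (A x) (A y)) ->
  subhg E G.
Proof.
move=> hE hA h1 h2; have [f [fi fA]] := distinct_representatives hA.
exists f; split => // F FE; have [] := hE F FE => /eqP.
  move=> /cards1P[x Fx]; rewrite Fx imset_set1.
  have /h1/fintype.subsetP/(_ _ (fA x)) : x \in singles E by rewrite inE -Fx.
  by rewrite inE.
move=> /cards2P[x [y [xy Fxy]]]; rewrite Fxy imsetU1 imset_set1.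
have /h2/completeP/(_ _ _ (fA x) (fA y)) : adj E x y by rewrite /adj xy -Fxy.
by case/andP.
Qed.

Lemma subhg_singles (T V : finType) (E : {set {set T}}) (G : {set {set V}}) (f : T -> V) :
  (forall F, F \in E -> f @: F \in G) ->
  forall x, x \in singles E -> f x \in singles G.
Proof. by move=> h x; rewrite !inE => /h; rewrite imset_set1. Qed.

Lemma subhg_adj (T V : finType) (E : {set {set T}}) (G : {set {set V}}) (f : T -> V) :
  injective f -> (forall F, F \in E -> f @: F \in G) ->
  forall x y, adj E x y -> adj G (f x) (f y).
Proof.
move=> fi h x y /andP[xy /h]; rewrite imsetU1 imset_set1 /adj => ->.
by rewrite (inj_eq fi) xy.
Qed.

(** * Colourings and closed paths *)

Lemma colorableP (T : finType) (E : {set {set T}}) k :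
  reflect (exists f : T -> 'I_k, forall x y, adj E x y -> f x != f y) (colorable E k).
Proof.
apply: (iffP existsP) => [[f /forall_inP hf]|[f hf]].
  exists f => x y /andP[xy /hf]; rewrite cards2 xy /= => /forall_inP/(_ x).
  by rewrite !inE eqxx => /(_ isT)/forall_inP/(_ y); rewrite !inE eqxx orbT xy => /(_ isT).
exists (finfun f); apply/forall_inP => F FE; apply/implyP => F2.
apply/forall_inP => x xF; apply/forall_inP => y yF; apply/implyP => xy; rewrite !ffunE.
apply: hf; rewrite /adj xy /=; suff -> : [set x; y] = F by [].
apply/eqP; rewrite eqEcard (eqP F2) cards2 xy andbT.
by apply/fintype.subsetP => z; rewrite !inE => /orP[]/eqP ->.
Qed.

Lemma colorableW (T : finType) (E : {set {set T}}) k l :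
  (k <= l)%N -> colorable E k -> colorable E l.
Proof.
move=> kl /colorableP[f hf]; apply/colorableP; exists (fun x => widen_ord kl (f x)).
by move=> x y /hf; apply: contraNneq => /(congr1 val) /= e; apply/eqP/val_inj.
Qed.

Lemma closed_path_singles m (i : 'I_m) :
  val i = 0%N \/ val i = m.-1 -> i \in singles (closed_path m).
Proof.
move=> h; rewrite !inE; apply/orP; left; apply/existsP; exists i; rewrite eqxx /=.
by case: h => ->; rewrite eqxx ?orbT.
Qed.

Lemma closed_path_adj m (i j : 'I_m) : val j = (val i).+1 -> adj (closed_path m) i j.
Proof.
move=> h; rewrite /adj !inE; apply/andP; split.
  by apply/eqP => /(congr1 val); rewrite h => /n_Sn.
by apply/orP; right; apply/existsP; exists i; apply/existsP; exists j; rewrite h !eqxx.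
Qed.

Lemma subhg_closed_path m (T : finType) (E : {set {set T}}) (p : 'I_m -> T) :
  injective p ->
  (forall i, val i = 0%N \/ val i = m.-1 -> p i \in singles E) ->
  (forall i j, val j = (val i).+1 -> adj E (p i) (p j)) ->
  subhg (closed_path m) E.
Proof.
move=> pi h1 h2; exists p; split => // F; rewrite inE => /orP[|].
  case/existsP => i /andP[/eqP -> hi]; rewrite imset_set1.
  have /h1 : val i = 0%N \/ val i = m.-1 by case/orP: hi => /eqP; auto.
  by rewrite inE.
case/existsP => i /existsP[j /andP[/eqP /h2 /andP[_ h] /eqP ->]].
by rewrite imsetU1 imset_set1.
Qed.

(** * From the edge weight to the limit *)

Definition weight n (G : {set {set 'I_n}}) : nat :=
  #|singles G| * n + edges (adj G) [set: 'I_n] [set: 'I_n].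

Section Density.
Variables (R : realType) (T : finType) (E : {set {set T}}).
Hypothesis E12 : rank12 E.

Lemma rank12_ranks_sub n (G : {set {set 'I_n}}) : ranks_sub G E <-> rank_1_or_2 G.
Proof.
case: E12 => hE [[F1 [F1E c1]] [F2 [F2E c2]]]; split => hG F FG.
  by have [F' [F'E <-]] := hG F FG; apply: hE.
by have [->|->] := hG F FG; [exists F1 | exists F2].
Qed.

(** Replacing [n (n - 1)] by [n^2] in the density costs a linear term, paid for by the half of [eps]
    that is kept back. *)
Lemma pin_upper (L : R) : 0 <= L ->
  (forall eps : R, 0 < eps -> exists N : nat, forall n (G : {set {set 'I_n}}),
    (N <= n)%N -> rank_1_or_2 G -> (L + eps) * n%:R ^+ 2 <= (weight G)%:R -> subhg E G) ->
  forall eps : R, 0 < eps -> exists N : nat, forall n, (N <= n)%N -> pin R E n <= L + eps.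
Proof.
move=> L0 H eps eps0; have [N hN] := H (eps / 2) ltac:(lra).
exists (maxn N (maxn 2 (Num.bound (2 * (L + eps) / eps)))) => n.
rewrite !geq_max => /and3P[Nn n2 bn].
have hn : 2 * (L + eps) <= eps * n%:R.
  rewrite mulrC [eps * _]mulrC [_ * 2]mulrC -ler_pdivrMr //; apply: ltW.
  by apply: lt_le_trans (archi_boundP _) _; [apply: divr_ge0; lra | rewrite ler_nat].
apply: bigmax_le => [|G /asboolP[/rank12_ranks_sub hG nG]]; first lra.
rewrite leNgt; apply/negP => hd; apply: nG; apply: hN => //.
move: hd; rewrite hdensE // /weight natrD natrM.
set s := #|_|%:R; set e := (edges _ _ _)%:R.
have n2' : 2 <= n%:R :> R by rewrite (ler_nat R 2).
have nn0 : 0 < n%:R * (n%:R - 1) :> R by apply: mulr_gt0; lra.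
have s0 : 0 <= s by exact: ler0n.
rewrite -(ltr_pM2r nn0) [ltRHS]mulrDl divfK ?gt_eqF // [s / _ * _]mulrA divfK;
  last by rewrite gt_eqF //; lra.
move=> h.
have : 2 * (L + eps) * n%:R <= eps * n%:R * n%:R by rewrite ler_pM2r //; lra.
lra.
Qed.

Lemma pin_lower (L c : R) :
  (forall n, (0 < n)%N -> exists G : {set {set 'I_n}},
    [/\ rank_1_or_2 G, ~ subhg E G & L * n%:R ^+ 2 - c * n%:R <= (weight G)%:R]) ->
  forall eps : R, 0 < eps -> exists N : nat, forall n, (N <= n)%N -> L - eps <= pin R E n.
Proof.
move=> H eps eps0; exists (maxn 2 (Num.bound (`|c| / eps))) => n.
rewrite geq_max => /andP[n2 bn]; have [G [hG nG hw]] := H n (ltnW n2).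
have hn : c <= eps * n%:R.
  apply: le_trans (ler_norm _) _; rewrite mulrC -ler_pdivrMr //; apply: ltW.
  by apply: lt_le_trans (archi_boundP _) _; [apply: divr_ge0 => //; lra | rewrite ler_nat].
apply: (@le_trans _ _ (hdens R G)); last first.
  rewrite /pin; apply: le_bigmax_cond; apply/asboolP; split => //.
  exact/rank12_ranks_sub.
rewrite hdensE //; move: hw; rewrite /weight natrD natrM.
set s := #|_|%:R; set e := (edges _ _ _)%:R.
have n2' : 2 <= n%:R :> R by rewrite (ler_nat R 2).
have e0 : 0 <= e by exact: ler0n.
have nn0 : 0 < n%:R * (n%:R - 1) :> R by apply: mulr_gt0; lra.
have nn : 0 < n%:R ^+ 2 :> R by rewrite exprn_gt0 //; lra.
(* Here the change of denominator goes in the right direction, so only [c * n] is lost. *)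
have he : e / n%:R ^+ 2 <= e / (n%:R * (n%:R - 1)).
  by apply: ler_wpM2l => //; rewrite lef_pV2 ?posrE // expr2 ler_pM2l; lra.
move=> hw; apply: le_trans (lerD (lexx _) he).
rewrite -(ler_pM2r nn) [leRHS]mulrDl divfK ?gt_eqF // expr2 [s / _ * _]mulrA divfK;
  last by rewrite gt_eqF //; lra.
have : c * n%:R <= eps * n%:R * n%:R by rewrite ler_pM2r //; lra.
move: hw; lra.
Qed.

Local Open Scope classical_set_scope.

Lemma pin_cvg (L c : R) : 0 <= L ->
  (forall n, (0 < n)%N -> exists G : {set {set 'I_n}},
    [/\ rank_1_or_2 G, ~ subhg E G & L * n%:R ^+ 2 - c * n%:R <= (weight G)%:R]) ->
  (forall eps : R, 0 < eps -> exists N : nat, forall n (G : {set {set 'I_n}}),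
    (N <= n)%N -> rank_1_or_2 G -> (L + eps) * n%:R ^+ 2 <= (weight G)%:R -> subhg E G) ->
  pin R E @ \oo --> L.
Proof.
move=> L0 hl hu; apply/cvgrPdist_le => eps eps0.
have [N1 h1] := pin_lower hl eps0; have [N2 h2] := pin_upper L0 hu eps0.
exists (maxn N1 N2) => // n /=; rewrite geq_max => /andP[/h1 l1 /h2 l2].
by rewrite ler_distl; apply/andP; split; lra.
Qed.

End Density.

(** * Upper bounds *)

Section UpperBounds.
Variable R : realType.

(** The [u] vertices of [U] send at least [t.+1 * #|V|] edges to [X], so [common_neighbourhood]
    applies. As [u] depends only on [t] and [eta], [U] may itself be a part found by
    [erdos_stone]. *)
Lemma complete_sample (t : nat) (eta : R) : 0 < eta ->
  exists u N : nat, forall (V : finType) (r : rel V) (U X : {set V}),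
    symmetric r -> #|U| = u -> (N <= #|V|)%N ->
    (forall x, x \in U -> eta * #|V|%:R <= (deg r X x)%:R) ->
    exists W X' : {set V}, [/\ W \subset U, X' \subset X,
      (t <= #|W|)%N, (t <= #|X'|)%N & complete r X' W].
Proof.
move=> eta0; pose u := Num.bound (t.+1%:R / eta).
have hu : t.+1%:R <= eta * u%:R.
  rewrite mulrC -ler_pdivrMr //; apply/ltW/archi_boundP.
  by apply: divr_ge0 => //; exact: ltW.
exists u, (maxn (t * (u * 2 ^ u)) 1) => V r U X sr cU; rewrite geq_max => /andP[tV V0] hdeg.
have eU : (t.+1 * #|V| <= edges r X U)%N.
  rewrite edgesC // -(ler_nat R) /edges natr_sum natrM.
  apply: (@le_trans _ _ (\sum_(x in U) eta * #|V|%:R)); last exact: ler_sum.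
  rewrite sumr_const cU -[leRHS]mulr_natl mulrA ler_wpM2r ?ler0n //.
  by rewrite mulrC.
have [W [X' [WU cW X'X cX'W hX]]] := common_neighbourhood V0 (max_card _) eU.
exists W, X'; split => //; rewrite cU in hX.
have uu : (0 < u * 2 ^ u)%N by rewrite lt0n; apply/eqP => z; move: hX; rewrite z; lia.
by rewrite -(leq_pmul2r uu) (leq_trans tV).
Qed.

Lemma complete_sym (V : finType) (r : rel V) (A B : {set V}) :
  symmetric r -> complete r A B -> complete r B A.
Proof. by move=> sr /completeP h; apply/completeP => x y xB yA; rewrite sr; apply: h. Qed.

Variables (T : finType) (E : {set {set T}}).
Hypothesis E12 : rank_1_or_2 E.

(** Each colour class goes to its own part; all parts lie in [singles G], so the 1-edges of [H] are
    respected wherever they go. *)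
Lemma subhg_multipartite (V : finType) (G : {set {set V}}) k s :
  colorable E k -> size s = k -> multipartite (adj G) (singles G) #|T| s -> subhg E G.
Proof.
move=> /colorableP[c hc] ss /andP[/allP hs /(pairwiseP finset.set0) ps].
pose A x := nth finset.set0 s (c x).
have As x : A x \in s by rewrite mem_nth // ss.
apply: (@subhg_blowup _ _ _ _ A) => // [x|x _|x y /hc].
- by have /andP[_ /eqP ->] := hs _ (As x).
- by have /andP[] := hs _ (As x).
- move=> cxy; have [lt|lt|e] := ltngtP (c x) (c y).
  + by apply: ps => //; rewrite inE ss ltn_ord.
  + apply: complete_sym; first exact: adj_sym.
    by apply: ps => //; rewrite inE ss ltn_ord.
  + by rewrite (val_inj e) eqxx in cxy.
Qed.

Lemma edges_within (V : finType) (r : rel V) (S : {set V}) :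
  symmetric r ->
  (edges r [set: V] [set: V])%:R + #|S|%:R ^+ 2 <= (edges r S S)%:R + #|V|%:R ^+ 2 :> R.
Proof.
move=> sr; rewrite (edges_splitl r S) finset.setTI finset.setTD (edges_splitr S S) //.
rewrite finset.setTI finset.setTD.
have := edges_le r S (~: S); have := edges_le r (~: S) [set: V].
rewrite -!(ler_nat R) !natrM !natrD cardsT -(cardsC S) natrD.
set a := #|S|%:R; set b := #|~: S|%:R; lra.
Qed.

Lemma upper_nonbipartite k (eps : R) : (0 < k)%N -> 0 < eps -> colorable E k.+2 ->
  exists N : nat, forall n (G : {set {set 'I_n}}), (N <= n)%N ->
    (2 - k.+1%:R^-1 + eps) * n%:R ^+ 2 <= (weight G)%:R -> subhg E G.
Proof.
move=> k0 eps0 hc.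
have k1 : 0 < k.+1%:R :> R by rewrite ltr0n.
have [N hN] := @erdos_stone R k #|T| (k.+1%:R * eps) ltac:(by rewrite mulr_gt0).
exists N => n G Nn hw.
have [||s [ss ms]] := hN _ (adj G) (singles G) (@adj_sym _ _) (@adj_irr _ _).
- by rewrite card_ord.
- have := edges_within (singles G) (@adj_sym _ G).
  have : #|singles G|%:R <= n%:R :> R by rewrite ler_nat -[X in (_ <= X)%N]card_ord max_card.
  have s0 : 0 <= #|singles G|%:R :> R by exact: ler0n.
  move: hw; rewrite /weight natrD natrM card_ord.
  set m := #|_|%:R in s0 *; set e := (edges _ [set: _] _)%:R; set eS := (edges _ _ _)%:R.
  move=> hw mn h.
  have k2 : 1 <= k%:R :> R by rewrite (ler_nat R 1).
  have /(ler_wpM2l (ltW k1)) := hw.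
  rewrite mulrA [k.+1%:R * (_ + eps)]mulrDr mulrBr mulfV ?gt_eqF // => hw'.
  have := ler_wpM2l (ltW k1) h.
  (* After [edges_within] it remains to see that [k n^2 - (k + 1) m n + m^2] is non-negative. It
     factors in this way, and the second factor needs [k >= 1]. *)
  have : 0 <= (n%:R - m) * (k%:R * n%:R - m).
    rewrite mulr_ge0 // ?subr_ge0 //; apply: le_trans mn _.
    by rewrite ler_peMl ?ler0n.
  move: hw'; rewrite -[k.+1%:R]natr1; lra.
- exact: (subhg_multipartite hc ss ms).
Qed.

Lemma upper_five_fourths (eps : R) : 0 < eps -> bipartite E ->
  exists N : nat, forall n (G : {set {set 'I_n}}), (N <= n)%N ->
    (5 / 4 + eps) * n%:R ^+ 2 <= (weight G)%:R -> subhg E G.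
Proof.
move=> eps0 hc; have [N hN] := @erdos_stone R 0 #|T| eps eps0.
exists N => n G Nn hw.
have [||s [ss ms]] := hN _ (adj G) (singles G) (@adj_sym _ _) (@adj_irr _ _).
- by rewrite card_ord.
- have := edges_within (singles G) (@adj_sym _ G).
  move: hw; rewrite /weight natrD natrM card_ord.
  set m := #|_|%:R; set e := (edges _ [set: _] _)%:R; set eS := (edges _ _ _)%:R.
  (* The lower bound on [eS] from [edges_within] exceeds [eps n^2] by this square, which vanishes
     when half of the vertices are 1-edges. *)
  have : 0 <= (n%:R / 2 - m) ^+ 2 by exact: sqr_ge0.
  lra.
- exact: (subhg_multipartite hc ss ms).
Qed.

Lemma upper_one (eps : R) (c : T -> bool) : 0 < eps ->
  (forall x y, adj E x y -> c x != c y) -> (forall x, x \in singles E -> c x) ->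
  exists N : nat, forall n (G : {set {set 'I_n}}), (N <= n)%N ->
    (1 + eps) * n%:R ^+ 2 <= (weight G)%:R -> subhg E G.
Proof.
move=> eps0 hc c1; have eps4 : 0 < eps / 4 by lra.
have [u [N hN]] := complete_sample #|T| eps4.
exists (maxn N (Num.bound ((u%:R + 1) / (eps / 4)))).+1 => n G.
rewrite gtn_max => /andP[Nn bn] hw.
have n0 : 0 < n%:R :> R.
  rewrite ltr0n; apply: leq_ltn_trans bn; exact: leq0n.
set S := singles G in hw *; set r := adj G.
have sr : symmetric r := @adj_sym _ _.
have hn : u%:R + 1 <= eps / 4 * n%:R.
  rewrite mulrC -ler_pdivrMr //; apply: ltW; apply: lt_le_trans (archi_boundP _) _.
    by apply: divr_ge0; [rewrite addr_ge0 ?ler0n | lra].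
  by rewrite ler_nat ltnW.
(* [D] is an integer just above [eps / 4 * n]; the 1 in [u%:R + 1] pays for the rounding. *)
pose D := (Num.trunc (eps / 4 * n%:R)).+1.
have D1 : eps / 4 * n%:R <= D%:R by apply/ltW/truncnS_gt.
have D2 : D%:R <= eps / 4 * n%:R + 1.
  rewrite /D -natr1 lerD2r truncn_le mulr_ge0 ?ltW //.
clearbody D.
set Y := [set x in [set: 'I_n] | (D <= deg r S x)%N].
have uY : (u <= #|Y|)%N.
  have e1 : (edges r [set: 'I_n] [set: 'I_n] =
      edges r [set: 'I_n] S + (edges r (~: S) S + edges r (~: S) (~: S)))%N.
    rewrite (edges_splitl r S) finset.setTI finset.setTD (edgesC S) //.
    by rewrite (edges_splitr S (~: S)) // finset.setTI finset.setTD.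
  have e2 : (edges r (~: S) S <= edges r [set: 'I_n] S)%N.
    by rewrite (edges_splitl r S [set: 'I_n]) finset.setTI finset.setTD leq_addl.
  have e3 := edges_le r (~: S) (~: S).
  have e4 := edges_rich r [set: 'I_n] S D; rewrite -/Y cardsT card_ord in e4.
  have cS : (#|S| + #|~: S|)%:R = n%:R :> R by rewrite cardsC card_ord.
  move: hw e2 e3 e4; rewrite /weight -/S -/r e1 -!(ler_nat R) natrD in cS *.
  rewrite !natrD !natrM.
  set a := (edges _ [set: _] S)%:R; set b := (edges _ _ S)%:R.
  set d := (edges _ _ _)%:R; set s := #|S|%:R in cS *; set s' := #|_|%:R in cS *.
  set y := #|Y|%:R => hw e2 e3 e4.
  have s0 : 0 <= s by exact: ler0n.
  have s'0 : 0 <= s' by exact: ler0n.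
  have y0 : 0 <= y by exact: ler0n.
  have ss : 0 <= s * s' by exact: mulr_ge0.
  (* Apart from at most [2 a], the weight is at most [s n + s'^2 = n^2 - s s'], so [2 a] must cover
     the excess [eps n^2]. *)
  have ha : eps / 2 * n%:R ^+ 2 <= a.
    by move: hw; rewrite -cS in e2 e3 *; move: ss e2 e3; lra.
  have hy : y * s <= y * n%:R by rewrite ler_wpM2l // -cS; lra.
  have hD : D%:R * n%:R <= (eps / 4 * n%:R + 1) * n%:R by rewrite ler_wpM2r // ltW.
  rewrite -(ler_pM2r n0).
  have := ler_wpM2r (ltW n0) hn; move: ha e4 hy hD; lra.
have [||W [X [WU XS cW cX cXW]]] := hN _ r (trim u Y) S sr (card_trim uY).
- by rewrite card_ord ltnW.
- move=> x /(fintype.subsetP (trim_sub _ _)); rewrite !inE /= card_ord => hx.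
  by apply: le_trans D1 _; rewrite ler_nat.
apply: (@subhg_blowup _ _ _ _ (fun x => if c x then X else W)) => // [x|x /c1 ->|x y /hc].
- by case: ifP.
- by [].
- by case: (c x) (c y) => [] [] //= _; apply: complete_sym.
Qed.

Lemma upper_nine_eighths (eps : R) (c : T -> bool) : 0 < eps -> bipartite E ->
  (forall x y, adj E x y -> c x != c y) ->
  (forall x y, adj E x y -> x \in singles E -> y \notin singles E) ->
  exists N : nat, forall n (G : {set {set 'I_n}}), (N <= n)%N ->
    (9 / 8 + eps) * n%:R ^+ 2 <= (weight G)%:R -> subhg E G.
Proof.
move=> eps0 bip hc c1; have eps8 : 0 < eps / 8 by lra.
have [u [N1 hN1]] := complete_sample #|T| eps8.
have [N2 hN2] := @erdos_stone R 0 #|T| (eps / 8) eps8.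
have [N3 hN3] := @erdos_stone R 0 u (eps / 8) eps8.
exists (maxn (maxn N1 N2) (maxn N3 1)) => n G.
rewrite !geq_max => /andP[/andP[Nn1 Nn2] /andP[Nn3 n1]] hw.
set S := singles G in hw *; set r := adj G.
have sr : symmetric r := @adj_sym _ _.
have ir : irreflexive r := @adj_irr _ _.
rewrite -(card_ord n) in Nn1 Nn2 Nn3.
have [h|hS] := lerP (eps / 8 * n%:R ^+ 2) (edges r S S)%:R.
  have [|s [ss ms]] := hN2 _ r S sr ir Nn2; last exact: (subhg_multipartite bip ss ms).
  by rewrite mul0r add0r mul1r card_ord.
set B := [set x in ~: S | eps / 8 * n%:R <= (deg r S x)%:R].
have [h|hB] := lerP (eps / 8 * n%:R ^+ 2) (edges r B B)%:R.
  have [|s [ss ms]] := hN3 _ r B sr ir Nn3; first by rewrite mul0r add0r mul1r card_ord.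
  case: s ss ms => [//|U [//|U' [|//]]] _.
  rewrite /multipartite /= !andbT => /andP[/andP[/andP[UB /eqP cU] /andP[UB' /eqP cU']] cUU'].
  (* Each side of the complete bipartite graph inside [B] is thinned to vertices with [#|T|] common
     neighbours in [S]. *)
  have sample (Z : {set 'I_n}) : Z \subset B -> #|Z| = u -> exists W X : {set 'I_n},
      [/\ W \subset Z, X \subset S, (#|T| <= #|W|)%N, (#|T| <= #|X|)%N & complete r X W].
    move=> ZB cZ; apply: hN1 => // x /(fintype.subsetP ZB).
    by rewrite !inE card_ord => /andP[].
  have [W [X [WU XS cW cX cXW]]] := sample U UB cU.
  have [W' [X' [WU' XS' cW' cX' cXW']]] := sample U' UB' cU'.
  have cWW' := complete_sub WU WU' cUU'.
  (* The blow-up of P_4 has parts [X], [W], [W'], [X'] in this order. 1-edges go to the ends, other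
     vertices to the middle, and the colour fixes the parity of the position. Adjacent vertices are
     never both 1-edges, so [X] and [X'] need not be joined. *)
  pose A x := if c x then (if x \in singles E then X else W')
              else (if x \in singles E then X' else W).
  apply: (@subhg_blowup _ _ _ _ A) => // [x|x xE|x y xy]; rewrite /A.
  - by case: ifP => _; case: ifP.
  - by rewrite xE; case: ifP.
  - have := c1 x y xy; have := hc x y xy.
    case: (c x) (c y) => [] [] //= _; case: (x \in _); case: (y \in _) => //= xy1;
      by [have := xy1 isT | apply: (complete_sym sr)].
exfalso.
(* Vertices of [C] have few neighbours in [S]. The at most [d^2] pairs inside [C] are outweighed by
   the [d x] lost because these [d] vertices are not 1-edges. *)
set C := ~: B :\: S.
have BS : ~: B :&: S = S.
  apply/finset.setIidPr/fintype.subsetP => x xS.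
  by rewrite finset.in_setC inE finset.in_setC xS.
have cB : #|B|%:R + #|~: B|%:R = n%:R :> R by rewrite -natrD cardsC card_ord.
have cBC : #|~: B|%:R = #|S|%:R + #|C|%:R :> R by rewrite -natrD -{1}BS cardsID.
have eC : (edges r C S)%:R <= eps / 8 * n%:R * #|C|%:R.
  rewrite /edges natr_sum.
  apply: (@le_trans _ _ (\sum_(x in C) eps / 8 * n%:R)).
    apply: ler_sum => x; rewrite !inE => /andP[xS].
    by rewrite negb_and xS /= -ltNge => /ltW.
  by rewrite sumr_const -[leLHS]mulr_natl mulrC.
have eV : (edges r [set: 'I_n] [set: 'I_n] = edges r B B + 2 * edges r B (~: B) +
    (edges r S S + 2 * edges r C S + edges r C C))%N.
  rewrite (edges_splitl r B) !(edges_splitr B _ [set: 'I_n]) //.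
  rewrite !finset.setTI !finset.setTD.
  rewrite (edges_splitl r S (~: B) (~: B)) BS -/C.
  rewrite (edges_splitr S S (~: B)) // (edges_splitr S C (~: B)) //.
  rewrite BS -/C (edgesC (~: B) B) // (edgesC S C) //.
  lia.
have e1 := edges_le r B (~: B); have e2 := edges_le r C C.
move: hw e1 e2 hS hB; rewrite /weight -/S -/r eV -!(ler_nat R) !natrD !natrM.
move: eC cB cBC (ler0n R #|S|) (ler0n R #|B|) (ler0n R #|C|) (ltr0n R n).
set eCS := (edges r C S)%:R; set eSS := (edges r S S)%:R; set eCC := (edges r C C)%:R.
set eBB := (edges r B B)%:R; set eBD := (edges r B _)%:R.
set s := #|S|%:R; set b := #|B|%:R; set d := #|C|%:R; set m := #|~: B|%:R.
rewrite n1; set x := n%:R => eC cB cBC s0 b0 d0 x0 hw e1 e2 hS hB.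
have mE : m = x - b by lra.
have dx : d <= x by lra.
have q1 : d * d <= d * x by rewrite ler_wpM2l.
have q2 : eps / 8 * x * d <= eps / 8 * x * x.
  by rewrite ler_wpM2l // mulr_ge0 // ltW.
(* [(x - b) (x + 2 b) = 9 / 8 x^2 - 2 (b - x / 4)^2], while the error terms from [eBB], [eSS] and
   twice [eCS] add up to at most [eps / 2 * x^2]. *)
have q3 : 0 <= (b - x / 4) ^+ 2 by exact: sqr_ge0.
have q4 : 0 < eps * x ^+ 2 by rewrite mulr_gt0 // exprn_gt0.
have sE : s = x - b - d by lra.
rewrite mE in e1; rewrite sE in hw.
move: hw e1 e2 hS hB eC q1 q2 q3 q4; lra.
Qed.

End UpperBounds.

(** * Constructions for the lower bounds *)

Definition hypergraph12 (V : finType) (S : {set V}) (r : rel V) : {set {set V}} :=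
  [set F : {set V} | ((#|F| == 1) && (F \subset S)) ||
    ((#|F| == 2) && [forall x in F, forall y in F, (x != y) ==> r x y])]%N.

Section LowerBounds.

Lemma rank_hypergraph12 (V : finType) (S : {set V}) r : rank_1_or_2 (hypergraph12 S r).
Proof. by move=> F; rewrite inE => /orP[]/andP[/eqP]; auto. Qed.

Lemma singles_hypergraph12 (V : finType) (S : {set V}) r : singles (hypergraph12 S r) = S.
Proof. by apply/setP => x; rewrite !inE cards1 finset.sub1set orbF. Qed.

Lemma adj_hypergraph12 (V : finType) (S : {set V}) r x y :
  symmetric r -> adj (hypergraph12 S r) x y = (x != y) && r x y.
Proof.
move=> sr; rewrite /adj; case: eqP => //= xy; rewrite inE cards2.
move/eqP: xy => xy; rewrite xy /=; apply/forall_inP/idP => [/(_ x)|rxy a].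
  rewrite !inE eqxx => /(_ isT)/forall_inP/(_ y); rewrite !inE eqxx orbT xy.
  exact.
rewrite !inE => ha; apply/forall_inP => b; rewrite !inE => hb; apply/implyP.
by case/orP: ha => /eqP ->; case/orP: hb => /eqP ->; rewrite ?eqxx // sr.
Qed.

Lemma weight_hypergraph12 n (S : {set 'I_n}) r : symmetric r -> irreflexive r ->
  weight (hypergraph12 S r) = (#|S| * n + edges r [set: 'I_n] [set: 'I_n])%N.
Proof.
move=> sr ir; rewrite /weight singles_hypergraph12; congr (_ + _)%N.
apply: eq_bigr => x _; apply: eq_card => y; rewrite !inE adj_hypergraph12 //.
by case: eqP => [<-|//]; rewrite ir.
Qed.

Variables (R : realType) (T : finType) (E : {set {set T}}).

Lemma lower_nonbipartite k n : ~~ colorable E k.+1 ->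
  exists G : {set {set 'I_n}}, [/\ rank_1_or_2 G, ~ subhg E G &
    (2 - k.+1%:R^-1) * n%:R ^+ 2 - 1 * n%:R <= (weight G)%:R :> R].
Proof.
move=> nc; pose r : rel 'I_n := fun x y => (x %% k.+1 != y %% k.+1)%N.
have sr : symmetric r by move=> x y; rewrite /r eq_sym.
have ir : irreflexive r by move=> x; rewrite /r eqxx.
exists (hypergraph12 [set: 'I_n] r); split; first exact: rank_hypergraph12.
  case=> f [fi hf]; case/negP: nc; apply/colorableP.
  exists (fun x => inord (f x %% k.+1)) => x y /(subhg_adj fi hf).
  rewrite adj_hypergraph12 // => /andP[_]; apply: contraNneq => /(congr1 val).
  by rewrite /= !inordK ?ltn_mod // => ->.
rewrite weight_hypergraph12 // cardsT card_ord.
have h : (n * (n - (n %/ k.+1).+1) <= edges r [set: 'I_n] [set: 'I_n])%N.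
  have := @edges_ge _ r [set: 'I_n] [set: 'I_n] (n - (n %/ k.+1).+1).
  rewrite cardsT card_ord; apply => x _; rewrite leq_subLR addnC -{1}(card_ord n).
  rewrite -cardsT -(cardsID [set y | r x y] [set: 'I_n]) leq_add //.
    by apply: subset_leq_card; apply/fintype.subsetP => y; rewrite !inE.
  (* Within a residue class a vertex is determined by its quotient, so the class has at most
     [(n %/ k.+1).+1] elements. *)
  pose g (y : 'I_n) : 'I_(n %/ k.+1).+1 := inord (y %/ k.+1).
  rewrite -[X in (_ <= X)%N]card_ord -(@card_in_imset _ _ g) ?max_card // => y z.
  rewrite !inE !andbT /r !negbK => /eqP xy /eqP xz /(congr1 val).
  rewrite /= !inordK ?ltnS ?leq_div2r 1?ltnW // => yz; apply: val_inj => /=.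
  by rewrite (divn_eq y k.+1) (divn_eq z k.+1) yz -xy -xz.
rewrite natrD natrM.
have k1 : 0 < k.+1%:R :> R by rewrite ltr0n.
have q : (n %/ k.+1)%:R <= n%:R / k.+1%:R :> R.
  by rewrite ler_pdivlMr // -natrM ler_nat leq_trunc_div.
have n0 : 0 <= n%:R :> R by exact: ler0n.
have : n%:R * (n%:R - (n %/ k.+1)%:R - 1) <= (edges r [set: 'I_n] [set: 'I_n])%:R :> R.
  apply: le_trans (_ : (n * (n - (n %/ k.+1).+1))%:R <= _); last by rewrite ler_nat.
  rewrite natrM ler_wpM2l // -addrA -opprD natr1 lerBlDr -natrD ler_nat; lia.
have := ler_wpM2l n0 q.
set i := k.+1%:R^-1; set a := (n %/ k.+1)%:R; set e := (edges _ _ _)%:R; lra.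
Qed.

Lemma lower_one n : (exists x y, adj E x y) ->
  exists G : {set {set 'I_n}}, [/\ rank_1_or_2 G, ~ subhg E G &
    1 * n%:R ^+ 2 - 0 * n%:R <= (weight G)%:R :> R].
Proof.
move=> [x [y xy]]; pose r : rel 'I_n := fun _ _ => false.
exists (hypergraph12 [set: 'I_n] r); split; first exact: rank_hypergraph12.
  by case=> f [fi hf]; have := subhg_adj fi hf xy; rewrite adj_hypergraph12 ?andbF.
rewrite weight_hypergraph12 // cardsT card_ord natrD natrM expr2.
have := ler0n R (edges r [set: 'I_n] [set: 'I_n]); lra.
Qed.

Lemma lower_five_fourths n : subhg (closed_path 2) E ->
  exists G : {set {set 'I_n}}, [/\ rank_1_or_2 G, ~ subhg E G &
    5 / 4 * n%:R ^+ 2 - 2 * n%:R <= (weight G)%:R :> R].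
Proof.
move=> [p [pi hp]]; pose S := trim (n %/ 2) [set: 'I_n].
have cS : #|S| = (n %/ 2)%N by rewrite card_trim // cardsT card_ord leq_div.
pose r : rel 'I_n := fun x y => (x != y) && ~~ ((x \in S) && (y \in S)).
have sr : symmetric r by move=> x y; rewrite /r eq_sym [(x \in S) && _]andbC.
have ir : irreflexive r by move=> x; rewrite /r eqxx.
exists (hypergraph12 S r); split; first exact: rank_hypergraph12.
  case=> f [fi hf].
  have end_S i : f (p i) \in S.
    rewrite -[S](singles_hypergraph12 S r).
    apply/(subhg_singles hf)/(subhg_singles hp)/closed_path_singles.
    by case: i => [[|[|//]] ?]; [left | right].
  have := subhg_adj fi hf (subhg_adj pi hp (@closed_path_adj 2 ord0 ord_max erefl)).
  by rewrite adj_hypergraph12 // /r !end_S !andbF.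
rewrite weight_hypergraph12 // (edges_splitl r S) finset.setTI finset.setTD.
have h1 : (#|S| * #|~: S| <= edges r S [set: 'I_n])%N.
  apply: edges_ge => x xS; apply: subset_leq_card; apply/fintype.subsetP => y.
  rewrite finset.in_setC inE finset.in_setT /r xS /= => yS; rewrite yS andbT.
  by apply: contraNneq yS => <-.
have h2 : (#|~: S| * n.-1 <= edges r (~: S) [set: 'I_n])%N.
  apply: edges_ge => x; rewrite finset.in_setC => xS.
  have -> : n.-1 = #|[set~ x]| by rewrite cardsC1 card_ord.
  apply: subset_leq_card; apply/fintype.subsetP => y; rewrite !inE /r (negPf xS) /=.
  by rewrite andbT eq_sym.
have c : (#|S| + #|~: S| = n)%N by rewrite cardsC card_ord.
move: h1 h2 c; rewrite cS; set m := (n %/ 2)%N; set m' := #|_| => h1 h2 c.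
have [mn1 mn2] : (2 * m <= n /\ n <= 2 * m + 1)%N by rewrite /m; lia.
have n1 : n%:R - 1 <= n.-1%:R :> R by rewrite lerBlDr natr1 ler_nat; lia.
move: h1 h2 mn1 mn2; rewrite -!(ler_nat R) !natrD !natrM => h1 h2 mn1 mn2.
have c' : m'%:R = n%:R - m%:R :> R by rewrite -c natrD; lra.
have := ler_wpM2l (ler0n R m') n1.
have n0 : 0 <= n%:R :> R by exact: ler0n.
have m0 : 0 <= m%:R :> R by exact: ler0n.
(* [n - 2 m] is 0 or 1, so the rounding loss [(n - 2 m)^2 / 4] is at most linear. *)
have : 0 <= (n%:R - 2 * m%:R) * (1 - (n%:R - 2 * m%:R)) :> R by rewrite mulr_ge0 //; lra.
rewrite c' in h1 h2 *; lra.
Qed.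

(** A path in the complete bipartite graph alternates between [S] and its complement; with both ends
    in [S] it has an odd number of vertices, so no even closed path fits. *)
Lemma lower_nine_eighths k n : (0 < n)%N -> (0 < k)%N -> subhg (closed_path (2 * k)) E ->
  exists G : {set {set 'I_n}}, [/\ rank_1_or_2 G, ~ subhg E G &
    9 / 8 * n%:R ^+ 2 - 2 * n%:R <= (weight G)%:R :> R].
Proof.
move=> n_gt0 k0 [p [pi hp]]; pose S := trim ((3 * n) %/ 4) [set: 'I_n].
have cS : #|S| = ((3 * n) %/ 4)%N by rewrite card_trim // cardsT card_ord; lia.
pose r : rel 'I_n := fun x y => (x \in S) != (y \in S).
have sr : symmetric r by move=> x y; rewrite /r eq_sym.
have ir : irreflexive r by move=> x; rewrite /r eqxx.
exists (hypergraph12 S r); split; first exact: rank_hypergraph12.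
  case=> f [fi hf].
  have s1 i : val i = 0%N \/ val i = (2 * k).-1 -> f (p i) \in S.
    move=> /closed_path_singles/(subhg_singles hp)/(subhg_singles hf).
    by rewrite singles_hypergraph12.
  have alt i (hi : (i < 2 * k)%N) : (f (p (Ordinal hi)) \in S) = ~~ odd i.
    elim: i hi => [|i IH] hi; first by apply: s1; left.
    have hi' : (i < 2 * k)%N by exact: ltnW.
    have := subhg_adj fi hf (subhg_adj pi hp
      (@closed_path_adj _ (Ordinal hi') (Ordinal hi) erefl)).
    rewrite adj_hypergraph12 // /r (IH hi') => /andP[_] /=.
    by case: (odd i); case: (_ \in S).
  have hk : ((2 * k).-1 < 2 * k)%N by lia.
  have := alt _ hk; rewrite s1; last by right.
  by move=> /esym; have -> : odd (2 * k).-1 by lia.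
rewrite weight_hypergraph12 // (edges_splitl r S) finset.setTI finset.setTD.
have h1 : (#|S| * #|~: S| <= edges r S [set: 'I_n])%N.
  apply: edges_ge => x xS; apply: subset_leq_card; apply/fintype.subsetP => y.
  by rewrite finset.in_setC inE finset.in_setT /r xS => /negPf ->.
have h2 : (#|~: S| * #|S| <= edges r (~: S) [set: 'I_n])%N.
  apply: edges_ge => x; rewrite finset.in_setC => /negPf xS.
  apply: subset_leq_card; apply/fintype.subsetP => y.
  by rewrite inE finset.in_setT /r xS => ->.
have c : (#|S| + #|~: S| = n)%N by rewrite cardsC card_ord.
move: h1 h2 c; rewrite cS; set m := ((3 * n) %/ 4)%N; set m' := #|_| => h1 h2 c.
have [mn1 mn2] : (4 * m <= 3 * n /\ 3 * n <= 4 * m + 3)%N by rewrite /m; lia.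
move: h1 h2 mn1 mn2; rewrite -!(ler_nat R) !natrD !natrM => h1 h2 mn1 mn2.
have c' : m'%:R = n%:R - m%:R :> R by rewrite -c natrD; lra.
have n0 : 0 <= n%:R :> R by exact: ler0n.
have n1 : 1 <= n%:R :> R by rewrite (ler_nat R 1).
(* [3 n - 4 m] lies between 0 and 3, which bounds the rounding loss [(3 n - 4 m)^2 / 8]. *)
have : 0 <= (3 * n%:R - 4 * m%:R) * (3 - (3 * n%:R - 4 * m%:R)) :> R.
  by rewrite mulr_ge0 //; lra.
rewrite c' in h1 h2 *; lra.
Qed.

End LowerBounds.

(** * Two-colourings and the four cases *)

Lemma bipartite_coloring (T : finType) (E : {set {set T}}) : bipartite E ->
  exists c : T -> bool, forall x y, adj E x y -> c x != c y.
Proof.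
move=> /colorableP[f hf]; exists (fun x => f x == ord0) => x y /hf.
by case: (f x) => [[|[|//]] ?]; case: (f y) => [[|[|//]] ?].
Qed.

(** A simple path between two 1-edges of different colours would be an even closed path. Hence all
    1-edges in a component of [H^2] have one colour, and the colouring can be flipped on components
    where it is the wrong one. *)
Lemma one_sided_coloring (T : finType) (E : {set {set T}}) : bipartite E ->
  (forall k, (0 < k)%N -> ~ subhg (closed_path (2 * k)) E) ->
  exists c : T -> bool, (forall x y, adj E x y -> c x != c y) /\
    forall x, x \in singles E -> c x.
Proof.
move=> /bipartite_coloring[c hc] nP.
have same x y : x \in singles E -> y \in singles E -> connect (adj E) x y -> c x = c y.
  move=> xE yE /connectP[p0 hp0 yp0]; move: yE; rewrite {}yp0.
  (* A path without repeated vertices is required for the embedding to be injective. *)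
  case: (shortenP hp0) => p hp up _ yE; apply/eqP/negPn/negP => cxy.
  pose q := x :: p.
  have alt i : (i < size q)%N -> c (nth x q i) = c x (+) odd i.
    elim: i => [|i IH] hi; first by rewrite addbF.
    have /pathP/(_ i) := hp => /(_ x hi)/hc.
    rewrite IH ?(ltnW hi) //= -/q.
    by case: (c x); case: (odd i); case: (c _).
  have odd_p : odd (size p).
    move: cxy; rewrite (last_nth x) alt //; by case: (c x); case: (odd _).
  have qk : size q = (2 * (size q)./2)%N by rewrite mul2n even_halfK //= odd_p.
  have lt_q (i : 'I_(2 * (size q)./2)) : (i < size q)%N.
    by apply: leq_trans (ltn_ord i) _; rewrite -qk.
  apply: (nP (size q)./2); first by rewrite half_gt0 /=; case: (size p) odd_p.
  apply: (@subhg_closed_path _ _ _ (fun i => nth x q i)).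
  - by move=> i j /eqP; rewrite nth_uniq // => /eqP; exact: val_inj.
  - by move=> i [->//|/= ->]; rewrite -qk -(last_nth x).
  - move=> i j /= ij; rewrite ij; apply: (pathP x hp).
    by have := lt_q j; rewrite ij.
(* [b] marks the components to flip: those containing a 1-edge coloured false. *)
pose b x := [exists y, [&& y \in singles E, connect (adj E) x y & ~~ c y]].
have cs : connect_sym (adj E) by apply: sym_connect_sym; exact: adj_sym.
exists (fun x => c x (+) b x); split => [x y xy|x xE].
  have -> : b y = b x.
    apply: eq_existsb => z; congr [&& _, _ & _].
    by rewrite (same_connect cs (connect1 xy)).
  by move: (hc x y xy); case: (c x); case: (c y); case: (b x).
case cx: (c x) => /=.
  apply/negP => /existsP[y /and3P[yE xy]]; rewrite -(same x y xE yE xy) cx //.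
by apply/existsP; exists x; rewrite xE connect0 cx.
Qed.

Local Open Scope classical_set_scope.

Theorem mainTheorem11 (R : realType) (T : finType) (E : {set {set T}}) :
  rank12 E ->
  (~~ bipartite E ->
     (pin R E) @ \oo --> (2 - ((chi E)%:R - 1)^-1 : R)) /\
  (bipartite E -> subhg (closed_path 2) E ->
     (pin R E) @ \oo --> (5 / 4 : R)) /\
  (bipartite E -> (exists k, (0 < k)%N /\ subhg (closed_path (2 * k)) E) ->
     ~ subhg (closed_path 2) E ->
     (pin R E) @ \oo --> (9 / 8 : R)) /\
  (bipartite E -> (forall k, (0 < k)%N -> ~ subhg (closed_path (2 * k)) E) ->
     (pin R E) @ \oo --> (1 : R)).
Proof.
move=> E12; have hE : rank_1_or_2 E by case: E12.
split=> [nb|].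
  rewrite /chi; case: ex_minnP => m hm mmin.
  have m3 : (2 < m)%N.
    by rewrite ltnNge; apply: contra nb => m2; apply: colorableW hm.
  (* The chromatic number is [k + 2] with [k >= 1]: the upper bound uses the colouring with [k + 2]
     colours, the lower bound that [k + 1] colours do not suffice. *)
  case: m => [|[|k]] // in hm mmin m3 *.
  rewrite -[k.+2%:R]natr1 addrK; apply: (@pin_cvg _ _ _ E12 _ 1).
  - rewrite subr_ge0; apply: le_trans (_ : 1 <= _); last lra.
    by rewrite invf_le1 ?ltr0n // (ler_nat R 1).
  - move=> n _; apply: lower_nonbipartite; apply/negP => /mmin.
    by rewrite ltnn.
  - move=> eps eps0; have [N hN] := @upper_nonbipartite R _ _ hE k eps m3 eps0 hm.
    by exists N => n G Nn _; apply: hN.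
split=> [b P2|].
  apply: (@pin_cvg _ _ _ E12 _ 2); first lra.
  - by move=> n _; apply: lower_five_fourths.
  - move=> eps eps0; have [N hN] := @upper_five_fourths R _ _ hE eps eps0 b.
    by exists N => n G Nn _; apply: hN.
split=> [b [k [k0 Pk]] nP2|b nP].
  apply: (@pin_cvg _ _ _ E12 _ 2); first lra.
  - by move=> n n0; apply: lower_nine_eighths Pk.
  - have [c hc] := bipartite_coloring b.
    (* Two adjacent 1-edges form a closed path on two vertices. *)
    have nadj x y : adj E x y -> x \in singles E -> y \notin singles E.
      move=> xy xE; apply/negP => yE; apply: nP2.
      apply: (@subhg_closed_path 2 _ _ (fun i => if i == ord0 then x else y)).
      + have /andP[nxy _] := xy.
        move=> [[|[|//]] hi] [[|[|//]] hj] //= e; try exact: val_inj.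
          by rewrite e eqxx in nxy.
        by rewrite e eqxx in nxy.
      + by move=> i _; case: ifP.
      + by move=> [[|[|//]] hi] [[|[|//]] hj].
    move=> eps eps0; have [N hN] := @upper_nine_eighths R _ _ hE eps c eps0 b hc nadj.
    by exists N => n G Nn _; apply: hN.
apply: (@pin_cvg _ _ _ E12 _ 0); first lra.
- move=> n _; apply: lower_one; case: E12 => _ [_ [F [FE /eqP/cards2P[x [y [xy Fxy]]]]]].
  by exists x, y; rewrite /adj xy -Fxy.
- have [c [hc c1]] := one_sided_coloring b nP.
  move=> eps eps0; have [N hN] := @upper_one R _ _ hE eps c eps0 hc c1.
  by exists N => n G Nn _; apply: hN.
Qed.
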